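(* Let $n\ge1$, $d\ge0$, and let $L_{d,n}$ be the $\mathbb{C}$-span of the linear forms $\ell^{(a)}_\beta$ ($0\le a\le d$, $\beta$ an $(n-2)$-element subset of $\langle n\rangle$) in the variables $p^{(a)}_\alpha$. Then this system of linear forms has a reduced normal form consisting of linear forms expressing each Pl\''ucker coordinate $p^{(b)}_\beta$ with $\beta$ not Northeast as a linear combination of Pl\''ucker coordinates indexed by Northeast elements; that is, for each $b\in\{0,\dots,d\}$ and each non-Northeast $\beta\in\binom{\langle n\rangle}{n}$ there is a linear form $p^{(b)}_\beta-\sum c\,p^{(c')}_\gamma\in L_{d,n}$ whose remaining terms are indexed by Northeast $\gamma$, and these forms constitute a basis of $L_{d,n}$.
   Context: $\langle n\rangle=\{\bar n<\dots<\bar1<1<\dots<n\}$ with $\bar\imath=-i$; $\binom{\langle n\rangle}{n}$ is the set of $n$-element subsets. The variables $p^{(a)}_\alpha$ ($\alpha\in\binom{\langle n\rangle}{n}$, $0\le a\le d$) are the coordinates $u^av^{d-a}\otimes e^*_{\alpha_1}\wedge\dots\wedge e^*_{\alpha_n}$ on $(S^d\mathbb{C}^2)^*\otimes\bigwedge^n\mathbb{C}^{2n}$, where $\mathbb{C}^{2n}$ has basis $e_{\bar n},\dots,e_n$. For $\beta=\{\beta_1<\dots<\beta_{n-2}\}\subseteq\langle n\rangle$, $\ell^{(a)}_\beta:=u^av^{d-a}\otimes\Omega\wedge e^*_{\beta_1}\wedge\dots\wedge e^*_{\beta_{n-2}}=\sum_{i\in[n]:\{i,\bar\imath\}\cap\beta=\emptyset}\epsilon_i\,p^{(a)}_{\beta\cup\{\bar\imath,i\}}$,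 with $\Omega=\sum_{i=1}^n e^*_{\bar\imath}\wedge e^*_i$ and $\epsilon_i$ the sign of the permutation sorting $(\bar\imath,i,\beta_1,\dots,\beta_{n-2})$. Each $\alpha\in\binom{\langle n\rangle}{n}$ corresponds to a partition in the $n\times n$ square via the lattice path from the lower-left to the upper-right corner whose $j$-th step is upward if the $j$-th smallest element of $\langle n\rangle$ lies in $\alpha$ and rightward otherwise (partition = boxes between the path and the top and left edges). $\alpha$ is Northeast if for every box $(r,c)$ of its partition (row from top, column from left) with $r>c$, the box $(c,r)$ also belongs to the partition. *)

(* Defs.v *)
From HB Require Import structures.
From mathcomp Require Import all_boot all_order all_algebra.
From mathcomp Require Import complex Rstruct.
From Stdlib Require Rdefinitions.
Set Implicit Arguments. Unset Strict Implicit. Unset Printing Implicit Defensive.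
Import Order.TTheory GRing.Theory Num.Theory.
Local Open Scope ring_scope.

(* The ordered set <n> = {bar n < ... < bar 1 < 1 < ... < n} is encoded by
   'I_(n.*2) with its natural order: position k < n is bar (n-k),
   position k >= n is (k - n + 1). For i : 'I_n (standing for i+1 in [n]):  *)
Definition bar_pos (n : nat) (i : 'I_n) : 'I_(n.*2) :=
  cast_ord (addnn n) (lshift n (rev_ord i)).
Definition pos_pos (n : nat) (i : 'I_n) : 'I_(n.*2) :=
  cast_ord (addnn n) (rshift n i).

Definition nsubset (n : nat) := {A : {set 'I_(n.*2)} | #|A| == n}.

Definition pcoord (n d : nat) := ('I_d.+1 * nsubset n)%type.

(* Box (r+1, c+1) (row from top, column from left; r c : 'I_n) of the
   partition of alpha: the (c+1)-th rightward step of the lattice path is at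
   position k (k not in alpha, exactly c non-elements below k), and the height
   of the path there (number of elements of alpha below k) is <= n - (r+1). *)
Definition in_partition (n : nat) (A : {set 'I_(n.*2)}) (r c : 'I_n) : bool :=
  [exists k : 'I_(n.*2),
    [&& k \notin A,
        #|[set j : 'I_(n.*2) | (j < k)%N & j \notin A]| == c
      & (#|[set j : 'I_(n.*2) | (j < k)%N & j \in A]| + r.+1 <= n)%N]].

Definition northeast (n : nat) (A : {set 'I_(n.*2)}) : bool :=
  [forall r : 'I_n, forall c : 'I_n,
     ((c < r)%N && in_partition A r c) ==> in_partition A c r].

(* the sign of the permutation sorting (bar i, i, beta_1, ..., beta_{n-2}),
   computed as (-1)^(number of inversions) *)
Definition eps (F : nzRingType) (n : nat) (B : {set 'I_(n.*2)}) (i : 'I_n) : F :=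
  (-1) ^+ (#|[set b in B | (b < bar_pos i)%N]| + #|[set b in B | (b < pos_pos i)%N]|).

(* A linear form in the variables p^(a)_alpha is represented by its
   coefficient vector, an element of lform F n d (F^o is F viewed as a vector
   space over itself, so that lform F n d has its vectType structure). *)
Definition lform (F : fieldType) (n d : nat) := {ffun pcoord n d -> F^o}.

Definition ell (F : fieldType) (n d : nat) (a : 'I_d.+1) (B : {set 'I_(n.*2)})
  : lform F n d :=
  [ffun y : pcoord n d =>
     \sum_(i < n | (bar_pos i \notin B) && (pos_pos i \notin B))
        eps F B i * ((y.1 == a) && (val y.2 == B :|: [set bar_pos i; pos_pos i]))%:R].

Definition Ldn (F : fieldType) (n d : nat) : {vspace lform F n d} :=
  <<[seq ell F a B | a <- enum 'I_d.+1,
                     B <- enum [set B : {set 'I_(n.*2)} | #|B|.+2 == n]]>>%VS.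

Notation CC := (complex Rdefinitions.R).

(* Main.v *)
Require Import Defs.
From HB Require Import structures.
From mathcomp Require Import all_boot all_order all_algebra.
From mathcomp Require Import complex Rstruct.
From mathcomp Require Import zify ring.
Set Implicit Arguments. Unset Strict Implicit. Unset Printing Implicit Defensive.
Import Order.TTheory GRing.Theory Num.Theory.
Local Open Scope ring_scope.

(** Encode an n-subset as a word whose letters, for i = n, ..., 1, record
    whether bar i and i belong to it.  The letters "both" and "none" carry the
    arms and legs of the Frobenius coordinates of the partition, and Northeast
    becomes the ballot condition: every suffix has at least as many "none" as
    "both".  The forms ell are the columns of the (signed) operator turning one
    "none" into "both"; up to sign this is the inclusion operator of a Boolean
    lattice, and together with its transpose it satisfies the sl2 commutation
    relation, whence injectivity on one side of the middle level.  Peeling off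
    the first letter then shows by induction that a functional vanishing on L
    and on the ballot words is zero, and that an element of L supported on
    ballot words is zero.  So L is a complement of the span of the Northeast
    coordinates, and the reduced forms are obtained by projecting the other
    coordinates onto L. *)

(** * Words over four letters, their balance and the ballot condition *)

Definition letter := (bool * bool)%type.
Definition none : letter := (false, false).
Definition both : letter := (true, true).

Definition cnt (x : letter) (w : seq letter) : nat := count_mem x w.
Arguments cnt : simpl never.

Definition wcard (w : seq letter) : nat := (\sum_(c <- w) (c.1 + c.2))%N.

Fixpoint ballot (w : seq letter) : bool :=
  if w is _ :: w' then
    (cnt both w <= cnt none w)%N && ballot w'
  else true.

(** By [wcard_bal] this is the length minus [wcard]. Hence [n]-subsets get balance 0, and the index
    sets of the forms [ell] get balance 2. *)
Definition bal (w : seq letter) : int :=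
  (cnt none w)%:Z - (cnt both w)%:Z.

Lemma cnt_cons x c w : cnt x (c :: w) = ((c == x) + cnt x w)%N.
Proof. by []. Qed.

Lemma wcard_cons c w : wcard (c :: w) = (c.1 + c.2 + wcard w)%N.
Proof. by rewrite /wcard big_cons. Qed.

Lemma wcard_bal w : (wcard w + cnt none w = size w + cnt both w)%N.
Proof.
elim: w => [|c w IH]; first by rewrite /wcard big_nil.
rewrite wcard_cons !cnt_cons /=.
have -> : (c == none) = ~~ c.1 && ~~ c.2 by case: c => [[] []].
have -> : (c == both) = c.1 && c.2 by case: c => [[] []].
move: IH; move: (wcard w) (size w) (cnt none w) (cnt both w).
by case: c => [[] []] p q r s /=; lia.
Qed.

Lemma ballot_bal w : ballot w -> 0 <= bal w.
Proof. by rewrite /bal; case: w => [|c w] //= /andP[]; rewrite !cnt_cons; lia. Qed.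

Lemma bal_cons c w :
  bal (c :: w) = (c == none)%:Z - (c == both)%:Z + bal w.
Proof. by rewrite /bal !cnt_cons; lia. Qed.

Lemma ballot_cons c w : ballot (c :: w) = (0 <= bal (c :: w)) && ballot w.
Proof. by rewrite /bal; congr andb; lia. Qed.

(** Rewrites the balance of each suffix through [wcard_bal], so that the ballot condition can be
    compared with heights of the lattice path. *)
Lemma ballotE w :
  ballot w = [forall j : 'I_(size w).+1,
                (wcard (drop j w) <= size (drop j w))%N].
Proof.
elim: w => [|c w IH].
  by apply/esym/forallP=> j; rewrite /wcard big_nil.
rewrite ballot_cons IH; apply/andP/forallP=> [[h /forallP hw] j|h]; last split.
- case: (unliftP ord0 j) => [k|] ->; first exact: hw.
  rewrite [nat_of_ord _]/= drop0.
  by have := wcard_bal (c :: w); move: h; rewrite /bal; lia.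
- by have := wcard_bal (c :: w); have := h ord0; rewrite [nat_of_ord _]/= drop0 /bal; lia.
- by apply/forallP=> k; have := h (lift ord0 k).
Qed.

(** * The signed letter-replacement operator and its sl2 relation *)

Section Transfer.
Variable R : comNzRingType.
Implicit Types (f g : seq letter -> R) (w v u t : seq letter) (x y c : letter).

Definition sgn w : R := (-1) ^+ wcard w.

(** The sign counts the set elements recorded after the replaced letter, in agreement with [eps]
    (see [eps_word]). Recursion on the first letter suits the later peeling arguments. *)
Fixpoint transfer x y f w : R :=
  if w is c :: w' then
    (c == x)%:R * (sgn w' * f (y :: w')) + transfer x y (fun v => f (c :: v)) w'
  else 0.

Lemma transferE x y f w :
  transfer x y f w = \sum_(j < size w)
    (nth none w j == x)%:R * (sgn (drop j.+1 w) * f (set_nth none w j y)).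
Proof.
elim: w f => [|c w IH] f; first by rewrite big_ord0.
by rewrite /= IH big_ord_recl /= drop0.
Qed.

Lemma transfer_ext x y f g w : f =1 g -> transfer x y f w = transfer x y g w.
Proof. by move=> fg; rewrite !transferE; apply: eq_bigr => j _; rewrite fg. Qed.

(** One replacement shifts both letter counts by one, so only the values of [f] on a single level
    matter. Functions on a level thus need no type of their own. *)
Lemma eq_transfer x y f g w : x != y ->
  (forall v, size v = size w -> cnt x w = (cnt x v).+1 ->
     cnt y v = (cnt y w).+1 -> f v = g v) ->
  transfer x y f w = transfer x y g w.
Proof.
move=> xy; elim: w f g => [|c w IH] f g //= fg; congr (_ + _).
  case: eqVneq fg => [->|_] fg; last by rewrite !mul0r.
  have yx : (y == x) = false by rewrite eq_sym (negbTE xy).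
  by rewrite fg //= !cnt_cons ?eqxx ?(negbTE xy) ?yx.
by apply: IH => v sv cx cy; apply: fg; rewrite /= ?cnt_cons ?sv ?cx ?cy ?addnS.
Qed.

Lemma transferD x y f g w :
  transfer x y (fun v => f v + g v) w = transfer x y f w + transfer x y g w.
Proof.
elim: w f g => [|c w IH] f g /=; first by rewrite addr0.
by rewrite IH; ring.
Qed.

Lemma transferZ x y a f w :
  transfer x y (fun v => a * f v) w = a * transfer x y f w.
Proof.
elim: w f => [|c w IH] f /=; first by rewrite mulr0.
by rewrite IH; ring.
Qed.

Lemma transfer0 x y w : transfer x y (fun=> 0) w = 0.
Proof. by elim: w => //= c w ->; rewrite !mulr0 addr0. Qed.

Lemma sgn_cons c w : sgn (c :: w) = (-1) ^+ (c.1 + c.2) * sgn w.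
Proof. by rewrite /sgn wcard_cons exprD. Qed.

Lemma sgn_sqr w : sgn w * sgn w = 1.
Proof. by rewrite /sgn -exprD addnn -mul2n exprM sqrrN expr1n expr1n. Qed.

(** Replacing a letter by one of equal parity does not change [sgn], which therefore behaves like a
    constant. This covers [none] and [both]. *)
Lemma transfer_sgn x y f w : odd (x.1 + x.2) = odd (y.1 + y.2) ->
  transfer x y (fun v => sgn v * f v) w = sgn w * transfer x y f w.
Proof.
move=> xy; elim: w f => [|c w IH] f /=; first by rewrite mulr0.
have -> : transfer x y (fun v => sgn (c :: v) * f (c :: v)) w =
    (-1) ^+ (c.1 + c.2) * (sgn w * transfer x y (fun v => f (c :: v)) w).
  rewrite -IH -transferZ; apply: transfer_ext => v.
  by rewrite sgn_cons mulrA.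
rewrite !sgn_cons; case: eqVneq => [->|_]; last by rewrite !mul0r !add0r mulrA.
have -> : (-1) ^+ (x.1 + x.2) = (-1) ^+ (y.1 + y.2) :> R.
  by rewrite -signr_odd xy signr_odd.
by move: ((-1) ^+ _) => a; rewrite !mul1r; ring.
Qed.

Lemma transfer_comm x y f w : x != y -> odd (x.1 + x.2) = odd (y.1 + y.2) ->
  transfer x y (transfer y x f) w - transfer y x (transfer x y f) w =
  ((cnt x w)%:R - (cnt y w)%:R) * f w.
Proof.
move=> xy pxy; have yx : (y == x) = false by rewrite eq_sym (negbTE xy).
elim: w f => [|c w IH] f; first by rewrite /= !subrr mul0r.
(* Split according to whether the first letter is changed twice, once or never. The terms changing
   it once are the same for both orders of composition and cancel in the commutator. *)
have E (a b : letter) : odd (a.1 + a.2) = odd (b.1 + b.2) -> a != b ->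
    transfer a b (transfer b a f) (c :: w) =
    (c == a)%:R * (f (a :: w) + sgn w * transfer b a (fun v => f (b :: v)) w) +
    ((c == b)%:R * (sgn w * transfer a b (fun v => f (a :: v)) w) +
     transfer a b (transfer b a (fun v => f (c :: v))) w).
  move=> pab ab /=; rewrite eqxx transferD !transferZ transfer_sgn //.
  by congr (_ + _); rewrite mul1r mulrDr mulrA sgn_sqr mul1r.
rewrite !E // 1?eq_sym //.
have := IH (fun v => f (c :: v)).
move: (transfer x y (transfer _ _ _) _) (transfer y x (transfer _ _ _) _) => p q.
move/eqP; rewrite subr_eq => /eqP ->.
rewrite !cnt_cons !natrD.
case: (eqVneq c x) => [->|_].
  by rewrite (negbTE xy) mulr1n mulr0n; ring.
by case: (eqVneq c y) => [->|_]; rewrite ?mulr1n mulr0n; ring.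
Qed.
End Transfer.

(** * Injectivity of the operator away from the middle level and on ballot words *)

Section Injectivity.
Variable R : numFieldType.
Implicit Types (f g : seq letter -> R) (w v u t : seq letter) (x y c : letter).

(* Each step applies transfer y x, which keeps the eigenvector property and
   moves two levels away from the middle, until no words are left. *)
Lemma transfer_eigen x y n (d m : nat) f :
  x != y -> odd (x.1 + x.2) = odd (y.1 + y.2) ->
  let W w := size w = n /\ cnt y w = (cnt x w + d.+1)%N in
  (forall w, W w -> transfer y x (transfer x y f) w = - m%:R * f w) ->
  forall w, W w -> f w = 0.
Proof.
move=> xy pxy.
have [k] := ubnP (n - d); elim: k d m f => // k IH d m f lek /= hf w [sw cw].
have dn : (d < n)%N.
  by have := count_size (pred1 y) w; rewrite -/(cnt y w) sw cw; apply: leq_trans; rewrite leq_addl.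
have comm v : size v = n -> cnt y v = (cnt x v + d.+1)%N ->
    transfer x y (transfer y x f) v = - (m + d.+1)%:R * f v.
  move=> sv cv; have := transfer_comm f v xy pxy.
  rewrite cv hf // !natrD => /eqP; rewrite subr_eq => /eqP ->; ring.
(* In characteristic zero the eigenvalue [- (m + d.+1)%:R] is nonzero, so [f] vanishes once this
   composite does. *)
suff g0 : transfer x y (transfer y x f) w = 0.
  move: (comm w sw cw); rewrite g0 => /esym/eqP.
  by rewrite mulf_eq0 oppr_eq0 pnatr_eq0 addnS /= => /eqP.
rewrite -[RHS](transfer0 R x y w); apply: eq_transfer => // v sv cx cy.
apply: (IH d.+2 (m + d.+1)%N) => [|u [su cu]|]; first by lia.
  rewrite -transferZ; apply: eq_transfer; first by rewrite eq_sym.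
  by move=> t st cty ctx; apply: comm; lia.
by split; lia.
Qed.

(** A function killed by [transfer x y] is an eigenvector of the composite for the eigenvalue 0, the
    case [m = 0] of [transfer_eigen]. *)
Lemma transfer_inj x y n (d : nat) f :
  x != y -> odd (x.1 + x.2) = odd (y.1 + y.2) ->
  (forall w, size w = n -> (cnt y w + 1 = cnt x w + d)%N ->
     transfer x y f w = 0) ->
  forall w, size w = n -> cnt y w = (cnt x w + d.+1)%N -> f w = 0.
Proof.
move=> xy pxy hf w sw cw; apply: (transfer_eigen (n := n) (d := d) (m := 0%N) xy pxy) => //.
move=> v [sv cv]; rewrite oppr0 mul0r -[RHS](transfer0 R y x v).
apply: eq_transfer; first by rewrite eq_sym.
by move=> u su cy cx; apply: hf; lia.
Qed.

(** For [s < 0] the letter [both] outnumbers [none] and [transfer_inj] applies. For [s >= 0] a word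
    of balance [s] is ballot as soon as its tail is, so the first letter can be fixed and induction
    used. *)
Lemma transfer_ballot_eq0 n (s : int) f :
  (forall w, size w = n -> bal w = s + 2 -> transfer none both f w = 0) ->
  (forall w, size w = n -> bal w = s -> ballot w -> f w = 0) ->
  forall w, size w = n -> bal w = s -> f w = 0.
Proof.
elim: n s f => [|n IH] s f hD hb w sw bw.
  by apply: hb => //; case: w sw bw.
case: (ltP s 0) => s0.
  apply: (@transfer_inj none both n.+1 `|s|.-1 f) => //; last by move: bw; rewrite /bal; lia.
  by move=> v sv cv; apply: hD => //; rewrite /bal; lia.
(* Words starting with [both] come first: their values are the head terms of the transfer at words
   starting with [none]. *)
have g0 v : size v = n -> bal v = s + 1 -> f (both :: v) = 0.
  apply: (IH _ (fun v => f (both :: v))) => {w sw bw v} v sv bv.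
    have := hD (both :: v); rewrite /= mul0r add0r; apply; first by rewrite sv.
    by rewrite bal_cons bv /=; lia.
  move=> hv; apply: hb; rewrite ?ballot_cons ?hv ?bal_cons ?bv /= ?sv //; lia.
case: w sw bw => // c w [sw]; rewrite bal_cons => bw.
apply: (IH (s - (c == none)%:Z + (c == both)%:Z) (fun v => f (c :: v))) => //; last by lia.
  move=> v sv bv; have := hD (c :: v); rewrite /=.
  case: (eqVneq c none) bv => [->|/negbTE cn] bv; last first.
    by rewrite mul0r add0r; apply; rewrite ?sv // bal_cons bv cn; lia.
  rewrite g0 ?mulr0 ?add0r //; last by rewrite bv /=; lia.
  by apply; rewrite ?sv // bal_cons bv /=; lia.
move=> v sv bv hv; apply: hb; rewrite ?ballot_cons /= ?sv ?bal_cons ?hv ?andbT //.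
  by lia.
by rewrite bv; lia.
Qed.

(** The counterpart for the transposed operator. Words of balance -1 are never ballot, so
    [transfer_inj] settles [s = -1]; for [s >= 0] a non-ballot tail makes the whole word non-ballot,
    and the first letter can be peeled off. *)
Lemma transfer_nballot_eq0 n (s : int) f : -1 <= s ->
  (forall w, size w = n -> bal w = s -> ~~ ballot w -> transfer both none f w = 0) ->
  forall w, size w = n -> bal w = s + 2 -> f w = 0.
Proof.
elim: n s f => [|n IH] s f s1 hU w sw bw.
  by case: w sw bw => // _; rewrite /bal /cnt /=; lia.
case: (ltP s 0) => s0.
  have {s0 s1} s1 : s = -1 by lia.
  apply: (@transfer_inj both none n.+1 0 f) => //; last by move: bw; rewrite /bal; lia.
  move=> v sv cv; have bv : bal v = s by rewrite /bal; lia.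
  by apply: hU => //; apply/negP=> /ballot_bal; lia.
have g0 v : size v = n -> bal v = s + 1 -> f (none :: v) = 0.
  move=> sv bv; apply: (IH (s - 1) (fun v => f (none :: v))) => //; [by lia| |by lia].
  move=> {w sw bw}w sw bw nw; have := hU (none :: w).
  rewrite /= mul0r add0r ; apply; rewrite ?sw //; first by rewrite bal_cons bw /=; lia.
  by apply: contra nw => /andP[].
case: w sw bw => // c w [sw]; rewrite bal_cons => bw.
apply: (IH (s - (c == none)%:Z + (c == both)%:Z) (fun v => f (c :: v))) => //; [| |by lia].
  by case: (c == none) (c == both) => [] []; lia.
move=> v sv bv nv; have := hU (c :: v); rewrite /=.
rewrite bal_cons bv negb_and nv orbT => /(_ _ _ isT) <-; [|by rewrite sv|by lia].
case: (eqVneq c both) bv => [->|_] bv; last by rewrite mul0r add0r.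
by rewrite g0 ?mulr0 ?add0r // bv /=; lia.
Qed.
End Injectivity.

(** * Subsets as words; signs and the Northeast condition in terms of words *)

Section Encoding.
Variable n : nat.
Implicit Types (A B : {set 'I_(n.*2)}) (i j : 'I_n) (p : 'I_(n.*2)).

Definition letter_at A i : letter := (bar_pos i \in A, pos_pos i \in A).

(** The outermost pair comes first, so a suffix describes an interval of positions symmetric about
    the centre. *)
Definition word A : seq letter := [seq letter_at A (rev_ord j) | j <- enum 'I_n].

Lemma pos_cases p : exists i, p = bar_pos i \/ p = pos_pos i.
Proof.
have -> : p = cast_ord (addnn n) (cast_ord (esym (addnn n)) p).
  by apply: val_inj.
case: (split_ordP (cast_ord (esym (addnn n)) p)) => i ->; last by exists i; right.
by exists (rev_ord i); left; rewrite /bar_pos rev_ordK.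
Qed.

Lemma bar_pos_inj : injective (@bar_pos n).
Proof. by move=> i j /cast_ord_inj/lshift_inj/rev_ord_inj. Qed.

Lemma pos_pos_inj : injective (@pos_pos n).
Proof. by move=> i j /cast_ord_inj/rshift_inj. Qed.

Lemma bar_pos_neq i j : (bar_pos i == pos_pos j) = false.
Proof. by apply/negbTE/eqP => /cast_ord_inj/eqP; rewrite eq_lrshift. Qed.

Lemma size_word A : size (word A) = n.
Proof. by rewrite size_map size_enum_ord. Qed.

Lemma nth_word A j : nth none (word A) j = letter_at A (rev_ord j).
Proof. by rewrite (nth_map j) ?size_enum_ord // nth_ord_enum. Qed.

Lemma letter_at_inj A B : (forall i, letter_at A i = letter_at B i) -> A = B.
Proof. by move=> AB; apply/setP=> p; have [i [->|->]] := pos_cases p; have [] := AB i. Qed.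

Lemma word_inj : injective word.
Proof.
move=> A B AB; apply: letter_at_inj => i.
by rewrite -(rev_ordK i) -!nth_word AB.
Qed.

Lemma word_surj (w : seq letter) : size w = n -> exists A, word A = w.
Proof.
move=> sw; pose c i := nth none w (rev_ord i).
exists ([set bar_pos i | i in 'I_n & (c i).1] :|: [set pos_pos i | i in 'I_n & (c i).2]).
apply: (@eq_from_nth _ none); rewrite size_word // => k kn.
rewrite -[k]/(val (Ordinal kn)) nth_word /letter_at !inE.
have -> : nth none w (Ordinal kn) = c (rev_ord (Ordinal kn)) by rewrite /c rev_ordK.
set i := rev_ord _; rewrite (surjective_pairing (c i)).
rewrite !mem_imset ?inE //; [|exact: pos_pos_inj|exact: bar_pos_inj].
have -> : (bar_pos i \in [set pos_pos i0 | i0 in 'I_n & (c i0).2]) = false.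
  by apply/negP=> /imsetP[j _ /eqP]; rewrite bar_pos_neq.
have -> : (pos_pos i \in [set bar_pos i0 | i0 in 'I_n & (c i0).1]) = false.
  by apply/negP=> /imsetP[j _ /eqP]; rewrite eq_sym bar_pos_neq.
by rewrite orbF.
Qed.

Lemma word_addpair B i :
  word (B :|: [set bar_pos i; pos_pos i]) = set_nth none (word B) (rev_ord i) both.
Proof.
apply: (@eq_from_nth _ none); first by rewrite size_set_nth !size_word; apply/esym/maxn_idPr.
rewrite size_word => k kn; rewrite nth_set_nth /=.
have -> : (k == n - i.+1)%N = (rev_ord (Ordinal kn) == i).
  by rewrite -val_eqE /=; have := ltn_ord i; lia.
rewrite -[k]/(val (Ordinal kn)) !nth_word.
rewrite /letter_at !inE !(inj_eq bar_pos_inj) !(inj_eq pos_pos_inj).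
rewrite bar_pos_neq [_ == bar_pos i]eq_sym bar_pos_neq orbF.
by case: eqVneq; rewrite ?orbT ?orbF.
Qed.

(** The height of the lattice path after [k] steps. *)
Definition height A (k : nat) : nat := #|[set j : 'I_(n.*2) | (j < k)%N & j \in A]|.

Lemma heightS A p : height A p.+1 = (height A p + (p \in A))%N.
Proof.
rewrite /height (cardsD1 p) inE ltnSn /= addnC; congr (_ + _)%N.
apply: eq_card => j; rewrite !inE ltnS leq_eqVlt val_eqE.
by case: eqVneq => [->|_] /=; rewrite ?ltnn.
Qed.

Lemma height0 A : height A 0 = 0%N.
Proof. by apply: eq_card0 => j; rewrite inE. Qed.

Lemma height_max A : height A n.*2 = #|A|.
Proof. by apply: eq_card => j; rewrite inE ltn_ord. Qed.

Lemma height_mono A k l : (k <= l)%N -> (height A k <= height A l)%N.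
Proof.
by move=> kl; apply: subset_leq_card; apply/subsetP => j; rewrite !inE => /andP[/leq_trans->].
Qed.

Lemma wcard_drop_word A k : (k <= n)%N ->
  (wcard (drop k (word A)) + height A k)%N = height A (n.*2 - k).
Proof.
move=> kn; have [m] := ubnP (n - k); elim: m k kn => // m IH k kn lem.
case: (ltnP k n) => [lt_kn|nk]; last first.
  by rewrite drop_oversize ?size_word // /wcard big_nil; congr height; lia.
pose i := rev_ord (Ordinal lt_kn).
rewrite (drop_nth none) ?size_word // wcard_cons.
rewrite -[X in nth _ _ X]/(val (Ordinal lt_kn)) nth_word -/i.
have hk : height A k.+1 = (height A k + (bar_pos i \in A))%N.
  have e : bar_pos i = k :> nat by rewrite /=; lia.
  by have := heightS A (bar_pos i); rewrite e.
have hk' : height A (n.*2 - k) = (height A (n.*2 - k.+1) + (pos_pos i \in A))%N.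
  have e : pos_pos i = (n.*2 - k.+1)%N :> nat by rewrite /=; lia.
  by have := heightS A (pos_pos i); rewrite e => <-; congr height; lia.
have := IH k.+1 lt_kn; rewrite hk hk' /letter_at /=; lia.
Qed.

Lemma wcard_word A : wcard (word A) = #|A|.
Proof. by rewrite -height_max -[n.*2]subn0 -wcard_drop_word // drop0 height0 addn0. Qed.

Lemma bal_word A k : (#|A| + k = n)%N -> bal (word A) = k.
Proof. by have := wcard_bal (word A); rewrite wcard_word size_word /bal; lia. Qed.

(** Elements below [bar_pos i] are counted twice by [eps], so only those between [bar_pos i] and
    [pos_pos i] affect the sign; they are the ones recorded by the suffix. *)
Lemma eps_word (R : comNzRingType) A i : bar_pos i \notin A ->
  eps R A i = sgn R (drop (rev_ord i).+1 (word A)).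
Proof.
move=> bA; have := @wcard_drop_word A (rev_ord i).+1 (ltn_ord _).
have -> : height A (rev_ord i).+1 = height A (bar_pos i).
  have := heightS A (bar_pos i); rewrite (negbTE bA) addn0 => <-.
  by congr height; rewrite /=.
have -> : (n.*2 - (rev_ord i).+1 = pos_pos i)%N by rewrite /=; have := ltn_ord i; lia.
move=> h; rewrite /eps /sgn.
have E p : #|[set b in A | (b < p)%N]| = height A p by apply: eq_card => b; rewrite !inE andbC.
rewrite !E -h addnCA exprD -[X in _ * X]signr_odd -[RHS]mulr1; congr (_ * _).
by rewrite addnn odd_double.
Qed.

Lemma height_nonmem A k : (k <= n.*2)%N ->
  (#|[set j : 'I_(n.*2) | (j < k)%N & j \notin A]| + height A k = k)%N.
Proof.
move=> kn; have := cardsID A [set j : 'I_(n.*2) | (j < k)%N].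
have -> : #|[set j : 'I_(n.*2) | (j < k)%N]| = k.
  by rewrite -sum1dep_card (big_ord_narrow kn) sum1_card card_ord.
move=> {3}<-; rewrite addnC.
by congr (_ + _)%N; apply: eq_card => j; rewrite !inE // andbC.
Qed.

(* The upper left and lower right corners of the box lie on the antidiagonal
   reached by the path after n + c - r steps. *)
Lemma in_partitionE A (r c : 'I_n) :
  in_partition A r c = (height A (n + c - r) + r.+1 <= n)%N.
Proof.
have rn := ltn_ord r; have cn := ltn_ord c.
apply/existsP/idP => [[k /and3P[kA /eqP kc hk]]|h].
  have := @height_nonmem A k (ltnW (ltn_ord k)).
  rewrite kc -/(height A k) in hk * => ek.
  have kp : (k.+1 <= n + c - r)%N by lia.
  have h1 : (height A (n + c - r) <= height A k.+1 + (n + c - r - k.+1))%N.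
    have : (n + c - r <= n.*2)%N by lia.
    move: (n + c - r)%N kp => q kq qn.
    have := height_nonmem A qn.
    have := @height_nonmem A k.+1 (ltn_ord k).
    set X := #|_|; set Y := #|_|.
    suff : (X <= Y)%N by lia.
    by apply: subset_leq_card; apply/subsetP => j; rewrite !inE => /andP[/leq_trans->].
  by move: h1; rewrite heightS (negbTE kA); lia.
(* For the least [l] with more than [c] non-elements among the first [l] positions, the last of
   these positions is the rightward step sought. *)
have ex : exists l, (c + height A l < l)%N by exists (n + c - r)%N; lia.
case: (ex_minnP ex) => [[|l]] // cl lmin.
have lq : (l < n + c - r)%N by apply: lmin; lia.
have ln : (l < n.*2)%N by lia.
pose k := Ordinal ln; exists k.
have lc : (l <= c + height A l)%N.
  by rewrite leqNgt; apply/negP => /lmin; rewrite ltnn.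
have := heightS A k; have := @height_nonmem A l (ltnW ln).
rewrite -/(height A k) /= in cl * => e1 e2.
have kA : k \notin A by case: (k \in A) e2 => // e2; lia.
by rewrite kA; apply/andP; split; [apply/eqP|]; rewrite ?(negbTE kA) in e2; lia.
Qed.

(** For [c < r] and [k = n + c - r], the boxes [(r, c)] and [(c, r)] are governed by the heights
    after [k] and [n.*2 - k] steps, which bound the window of the suffix after [k] letters. *)
Lemma northeastE A : #|A| = n -> northeast A = ballot (word A).
Proof.
move=> An; rewrite ballotE size_word.
have E (k : 'I_n.+1) : (wcard (drop k (word A)) <= size (drop k (word A)))%N =
    (height A (n.*2 - k) <= height A k + (n - k))%N.
  have kn : (k <= n)%N by rewrite -ltnS.
  by rewrite size_drop size_word -(wcard_drop_word A kn) addnC leq_add2l.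
apply/forallP/forallP => [ne k|h r].
  rewrite E; have kn : (k <= n)%N by rewrite -ltnS.
  case: (posnP k) => [->|k0]; first by rewrite subn0 height_max; lia.
  rewrite leqNgt; apply/negP => hk.
  have hn : (height A (n.*2 - k) <= n)%N by rewrite -{3}An -height_max height_mono; lia.
  have k_n : (k < n)%N.
    by rewrite ltn_neqAle kn andbT; apply/eqP => kE; move: hk; rewrite kE -addnn addnK; lia.
  (* Take the lowest box of the partition on the diagonal [c - r = k - n]. Its transpose lies in the
     partition exactly when the ballot inequality holds at [k]. *)
  have rn : (n - height A k - 1 < n)%N by lia.
  have cn : (k - height A k - 1 < n)%N by lia.
  have := implyP (forallP (ne (Ordinal rn)) (Ordinal cn)).
  rewrite !in_partitionE /=.
  have hkk : (height A k < k)%N.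
    by have := @height_nonmem A k; lia.
  have -> : (n + (k - height A k - 1) - (n - height A k - 1) = k)%N by lia.
  have -> : (n + (n - height A k - 1) - (k - height A k - 1) = n.*2 - k)%N by lia.
  lia.
apply/forallP => c; apply/implyP; rewrite !in_partitionE => /andP[cr hr].
have rn := ltn_ord r.
have kn : (n + c - r < n.+1)%N by lia.
have := h (Ordinal kn); rewrite E /=.
have -> : (n.*2 - (n + c - r) = n + r - c)%N by lia.
lia.
Qed.
End Encoding.

(** * The forms as columns of the operator, and the two halves of complementarity *)

Lemma transfer_sum (R : comNzRingType) (I : finType) x y (a : I -> R)
    (f : I -> seq letter -> R) w :
  transfer x y (fun v => \sum_i a i * f i v) w = \sum_i a i * transfer x y (f i) w.
Proof.
elim: w f => [|c w IH] f /=; first by rewrite big1 // => i _; rewrite mulr0.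
rewrite IH !mulr_sumr -big_split; apply: eq_bigr => i _ /=; ring.
Qed.

(** The matrices of the two operators are transposes: undoing a replacement leaves the suffix after
    it, hence the sign, unchanged. *)
Lemma transfer_adj (R : comNzRingType) x y v w : size v = size w ->
  transfer x y (fun u => (v == u)%:R) w =
  transfer y x (fun u => (u == w)%:R) v :> R.
Proof.
elim: w v => [|c w IH] [|c' v] //= [svw].
congr (_ + _).
  rewrite !eqseq_cons [c' == y]eq_sym [x == c]eq_sym.
  rewrite [y == c']eq_sym; case: (eqVneq v w) => [->|_]; last first.
    by rewrite !andbF !mulr0n !mulr0.
  by rewrite !andbT; case: (c == x); case: (c' == y); rewrite ?mulr0n ?mulr1n ?mulr0 ?mul0r.
case: (eqVneq c' c) => [->|cc].
  rewrite -[RHS](@transfer_ext _ _ _ (fun u => (u == w)%:R)); last first.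
    by move=> u; rewrite eqseq_cons eqxx.
  rewrite -IH //; by apply: transfer_ext => u; rewrite eqseq_cons eqxx.
rewrite (@transfer_ext _ _ _ _ (fun=> 0)); last first.
  by move=> u; rewrite eqseq_cons (negbTE cc).
rewrite transfer0 (@transfer_ext _ _ _ _ (fun=> 0)) ?transfer0 // => u.
by rewrite eqseq_cons (negbTE cc).
Qed.

(** The right side is the pairing of the functional [f] with the form attached to [B]. *)
Lemma transfer_word (R : comNzRingType) n (B : {set 'I_(n.*2)}) f :
  transfer none both f (word B) =
  \sum_(i < n | (bar_pos i \notin B) && (pos_pos i \notin B))
     eps R B i * f (word (B :|: [set bar_pos i; pos_pos i])).
Proof.
rewrite transferE size_word (reindex_inj rev_ord_inj) [RHS]big_mkcond.
apply: eq_bigr => i _; rewrite nth_word rev_ordK word_addpair.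
have -> : (letter_at B i == none) = (bar_pos i \notin B) && (pos_pos i \notin B).
  by rewrite /letter_at; case: (_ \in B) (_ \in B) => [] [].
case: ifP => [/andP[bB _]|_]; last by rewrite mul0r.
by rewrite mul1r eps_word.
Qed.

Section Reduction.
Variables (F : numFieldType) (n d : nat).
Implicit Types (a : 'I_d.+1) (B : {set 'I_(n.*2)}) (x y : pcoord n d).

Lemma ell_transfer a B y :
  ell F a B y = transfer none both
    (fun w => ((y.1 == a) && (word (val y.2) == w))%:R) (word B) :> F.
Proof.
rewrite transfer_word ffunE; apply: eq_bigr => i _.
by rewrite (inj_eq (@word_inj n)).
Qed.

Lemma word_of_bal w (k : nat) : size w = n -> bal w = k ->
  exists2 B : {set 'I_(n.*2)}, word B = w & (#|B| + k = n)%N.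
Proof.
move=> sw bw; have [B wB] := word_surj sw; exists B => //.
by have := wcard_bal w; rewrite -{1}wB wcard_word; move: bw; rewrite /bal; lia.
Qed.

(** Dual form of the claim that L and the Northeast coordinates together span everything; it reduces
    to [transfer_ballot_eq0] at [s = 0]. *)
Lemma Ldn_annihilator (phi : pcoord n d -> F) :
  (forall v, v \in Ldn F n d -> \sum_x phi x * v x = 0) ->
  (forall x, northeast (val x.2) -> phi x = 0) ->
  forall x, phi x = 0.
Proof.
move=> phiL phiNE x.
(* The degree [a] part of [phi], extended by zero to all words. Written as a sum, it lets
   [transfer_sum] turn its transfer into the pairing with [ell]. *)
pose f a (w : seq letter) :=
  \sum_(y : pcoord n d) phi y * ((y.1 == a) && (word (val y.2) == w))%:R : F.
have fE y : f y.1 (word (val y.2)) = phi y.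
  rewrite /f (bigD1 y) //= !eqxx mulr1 big1 ?addr0 // => z zy.
  rewrite (inj_eq (@word_inj n)) val_eqE -[_ && _]/(z == y) (negbTE zy).
  by rewrite mulr0.
rewrite -fE; have x2 : #|val x.2| = n by apply/eqP/(valP x.2).
apply: (@transfer_ballot_eq0 _ n 0 (f x.1)) => [w sw bw|w sw bw hw||].
- have [B <- BS] := @word_of_bal w 2 sw bw.
  rewrite transfer_sum -[RHS](phiL (ell F x.1 B)).
    by apply: eq_bigr => y _; rewrite ell_transfer.
  apply/memv_span/allpairsP; exists (x.1, B); rewrite !mem_enum inE; split=> //=.
  by rewrite inE -addn2; apply/eqP.
- have [B wB] := @word_of_bal w 0 sw bw; rewrite addn0 => /eqP BS.
  have -> : w = word (val (x.1, Sub B BS : nsubset n).2) by rewrite SubK.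
  rewrite (fE (x.1, Sub B BS)); apply: phiNE; rewrite /= northeastE ?wB //.
  by apply/eqP.
- exact: size_word.
- by rewrite (@bal_word _ _ 0) // addn0.
Qed.

(** By [transfer_adj] every element of L is, in each degree, an image under [transfer both none];
    its preimage is zero on balance 2 by [transfer_nballot_eq0]. *)
Lemma Ldn_northeast_eq0 v : v \in Ldn F n d ->
  (forall x, ~~ northeast (val x.2) -> v x = 0) -> v = 0.
Proof.
move=> vL vNE.
have [g vg] : exists g : 'I_d.+1 -> seq letter -> F,
    forall y, v y = transfer both none (g y.1) (word (val y.2)).
  have -> := coord_span (vL : v \in <<in_tuple _>>%VS).
  elim/big_ind: _ => [|v1 v2 [g1 h1] [g2 h2]|k _].
  - by exists (fun _ _ => 0) => y; rewrite ffunE transfer0.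
  - by exists (fun a w => g1 a w + g2 a w) => y; rewrite ffunE h1 h2 transferD.
  set X := in_tuple _; set c := coord _ _ _.
  have /allpairsP[[a B] [_ _ ->]] : X`_k \in val X by rewrite mem_nth ?size_tuple.
  exists (fun b w => c * ((b == a) && (w == word B))%:R) => y.
  rewrite ffunE transferZ ell_transfer; congr (_ * _).
  case: (y.1 == a) => /=; last by rewrite !transfer0.
  by rewrite transfer_adj // !size_word.
apply/ffunP => y; rewrite vg ffunE.
have y2 : #|val y.2| = n by apply/eqP/(valP y.2).
have : bal (word (val y.2)) = 0 by rewrite (@bal_word _ _ 0) // addn0.
have := size_word (val y.2); move: (word _) => u0 su0 bu0.
(* Only values of [g] on words of balance 2 enter, so their vanishing suffices. *)
rewrite -[RHS](transfer0 F both none u0).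
apply: eq_transfer => // u su cb cn; rewrite su0 in su.
apply: (@transfer_nballot_eq0 F n 0 (g y.1)) => //; last by move: bu0; rewrite /bal; lia.
move=> w sw bw nw; have [B wB] := @word_of_bal w 0 sw bw; rewrite addn0 => /eqP BS.
have := vNE (y.1, Sub B BS); rewrite vg /= wB; apply.
by rewrite northeastE ?wB //; apply/eqP.
Qed.
End Reduction.

(** * Linear algebra of coefficient vectors *)

Section Functions.
Variables (F : fieldType) (X : finType).
Implicit Types (V : {vspace {ffun X -> F^o}}) (x y : X).

Definition delta x : {ffun X -> F^o} := [ffun y => (y == x)%:R].

Lemma ffun_delta (v : {ffun X -> F^o}) : v = \sum_x v x *: delta x.
Proof.
apply/ffunP => y; rewrite sum_ffunE (bigD1 y) //= !ffunE eqxx.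
rewrite big1 ?addr0 => [|z zy]; first by rewrite /GRing.scale /= mulr1.
by rewrite !ffunE eq_sym (negbTE zy) /GRing.scale /= mulr0.
Qed.

(** Each coordinate of the projection onto a complement along [V] is a functional vanishing on [V].
    All of them are zero by hypothesis, so the projection is zero. *)
Lemma fullv_annihilator V :
  (forall phi : X -> F, (forall v, v \in V -> \sum_x phi x * v x = 0) ->
     forall x, phi x = 0) ->
  V = fullv.
Proof.
move=> hV; apply/eqP; rewrite eqEsubv subvf /=; apply/subvP => v _.
pose pi := daddv_pi V^C V.
have capV : (V^C :&: V = 0)%VS by rewrite capvC capv_compl.
have piV u : u \in V -> pi u = 0.
  move=> uV; have := daddv_pi_add capV (subvP (addvSr V^C V) u uV).
  rewrite (daddv_pi_id (capv_compl V) uV) => /(canRL (addrK _)).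
  by rewrite subrr.
have pi0 x : pi (delta x) = 0.
  apply/ffunP => y; rewrite [RHS]ffunE.
  apply: (hV (fun x => pi (delta x) y)) => u /piV/(congr1 (fun f : {ffun X -> F^o} => f y)).
  rewrite {1}(ffun_delta u) linear_sum sum_ffunE ffunE => h; rewrite -[RHS]h.
  by apply: eq_bigr => z _; rewrite linearZ ffunE mulrC.
have piv : pi v = 0.
  by rewrite (ffun_delta v) linear_sum big1 // => x _; rewrite linearZ /= pi0 scaler0.
have := @daddv_pi_add _ _ V^C%VS V v capV.
rewrite -/pi piv add0r addvC addv_complf memvf => /(_ isT) <-.
exact: memv_pi.
Qed.
End Functions.

Lemma span_vanish (F : fieldType) (X : finType) (s : seq {ffun X -> F^o}) v x :
  (forall u, u \in s -> u x = 0) -> v \in <<s>>%VS -> v x = 0.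
Proof.
move=> s0 vs; have -> := coord_span (vs : v \in <<in_tuple s>>%VS).
rewrite sum_ffunE big1 // => k _; rewrite ffunE s0 ?mem_nth //.
by rewrite /GRing.scale /= mulr0.
Qed.

(** * The reduced forms and their basis property *)

Lemma Ldn_reduced_form (F : numFieldType) (n d : nat) (x : pcoord n d) :
  exists l : lform F n d, l \in Ldn F n d /\
    forall y, ~~ northeast (val y.2) -> l y = (y == x)%:R :> F.
Proof.
pose W := <<[seq delta F z | z <- enum [pred z : pcoord n d | northeast (val z.2)]]>>%VS.
have W0 w y : w \in W -> ~~ northeast (val y.2) -> w y = 0.
  move=> wW hy; apply: span_vanish wW => _ /mapP[z hz ->].
  by rewrite mem_enum in hz; rewrite ffunE; case: eqVneq hy hz => // -> /negP.
have LW : (Ldn F n d + W)%VS = fullv.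
  apply: fullv_annihilator => phi phi0; apply: Ldn_annihilator => [v vL|z hz].
    by apply: phi0; rewrite (subvP (addvSl _ _)).
  rewrite -[RHS](phi0 (delta F z)); last first.
    apply: (subvP (addvSr _ _)); apply/memv_span/map_f.
    by rewrite mem_enum.
  rewrite (bigD1 z) //= ffunE eqxx mulr1 big1 ?addr0 // => y yz.
  by rewrite ffunE (negbTE yz) mulr0.
(* The L-component of [delta F x] is the reduced form, since the component in [W] vanishes off the
   Northeast coordinates. *)
have : delta F x \in (Ldn F n d + W)%VS by rewrite LW memvf.
case/memv_addP => l lL [w wW e]; exists l; split=> // y hy.
have := congr1 (fun f : lform F n d => f y) e.
by rewrite !ffunE (W0 w) // addr0.
Qed.

Lemma Ldn_reduced_basis (F : numFieldType) (n d : nat) :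
  exists f : pcoord n d -> lform F n d,
    (forall x y, ~~ northeast (val y.2) -> f x y = (y == x)%:R :> F) /\
    basis_of (Ldn F n d)
      [seq f x | x <- enum [pred x : pcoord n d | ~~ northeast (val x.2)]].
Proof.
have [f hf] := fin_all_exists (@Ldn_reduced_form F n d).
exists f; split=> [x y|]; first by case: (hf x) => _; apply.
set P := [pred x : pcoord n d | _].
have fE x y : ~~ northeast (val y.2) -> f x y = (y == x)%:R by case: (hf x) => _; apply.
rewrite /basis_of eqEsubv -andbA; apply/and3P; split.
- by apply/span_subvP => _ /mapP[x _ ->]; case: (hf x).
(* [u] has the same non-Northeast coefficients as [v], so [v - u] is an element of L supported on
   Northeast coordinates. *)
- apply/subvP => v vL; pose u := \sum_(x | P x) v x *: f x.
  have uf : u \in <<[seq f x | x <- enum P]>>%VS.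
    by apply: memv_suml => x hx; rewrite memvZ // memv_span // map_f // mem_enum.
  suff /eqP : v - u = 0 by rewrite subr_eq0 => /eqP ->.
  apply: Ldn_northeast_eq0 => [|y hy].
    by rewrite rpredB // memv_suml // => x _; rewrite memvZ //; case: (hf x).
  rewrite !ffunE sum_ffunE (bigD1 y) //= ffunE fE // eqxx big1 => [|x /andP[_ xy]].
    by rewrite /GRing.scale /= mulr1 addr0 subrr.
  by rewrite ffunE fE // eq_sym (negbTE xy) /GRing.scale /= mulr0.
have : uniq (enum P) by rewrite enum_uniq.
have : {subset enum P <= P} by move=> x; rewrite mem_enum.
elim: (enum P) => [_ _|x s IH hs /= /andP[xs us]]; first exact: nil_free.
rewrite free_cons IH ?andbT // => [|y ys]; last by apply: hs; rewrite inE ys orbT.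
have hx : ~~ northeast (val x.2) by apply: hs; rewrite inE eqxx.
(* Evaluation at [x] separates [f x] from the span of the remaining forms, all of which vanish
   there. *)
apply/negP => /(@span_vanish _ _ _ _ x) h.
suff /eqP : f x x = 0 :> F by rewrite fE // eqxx oner_eq0.
apply: h => _ /mapP[y ys ->]; rewrite fE //.
by case: eqVneq ys xs => [->|//] ->.
Qed.

Theorem theorem5p7 (n d : nat) :
  (1 <= n)%N ->
  exists f : pcoord n d -> lform CC n d,
    (forall x : pcoord n d, ~~ northeast (val x.2) ->
        f x x = 1 :> CC /\
        (forall y : pcoord n d, y != x -> f x y != 0 :> CC -> northeast (val y.2))) /\
    basis_of (Ldn CC n d)
      [seq f x | x <- enum [pred x : pcoord n d | ~~ northeast (val x.2)]].
Proof.
move=> _; have [f [hf fb]] := Ldn_reduced_basis CC n d.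
exists f; split=> // x hx; split=> [|y yx]; first by rewrite hf // eqxx.
by apply: contraR => hy; rewrite hf // (negbTE yx).
Qed.
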